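(* $\mathbb{B}$ sends bicoproducts to products. Namely, let $\frac{X}{G}$ and $\frac{Y}{H}$ be any pair of 0-cells in $\mathbb{S}$, and let $$\frac{X}{G}\xrightarrow{\ \frac{\alpha}{\theta}\ }\frac{X}{G}\amalg\frac{Y}{H}\xleftarrow{\ \frac{\beta}{\tau}\ }\frac{Y}{H}$$ be their bicoproduct in $\mathbb{S}$. Then the functor $$\Big(\big(\tfrac{\alpha}{\theta}\big)^{*},\big(\tfrac{\beta}{\tau}\big)^{*}\Big)\colon \mathbb{B}\Big(\frac{X}{G}\amalg\frac{Y}{H}\Big)\to\mathbb{B}\Big(\frac{X}{G}\Big)\times\mathbb{B}\Big(\frac{Y}{H}\Big)$$ is an equivalence of categories.
   Context: For a finite group $G$, ${}_G\mathrm{set}$ is the category of finite $G$-sets and $G$-equivariant maps. The strict 2-category $\mathbb{S}$. A 0-cell is a pair of a finite group $G$ and a finite $G$-set $X$, denoted $\frac{X}{G}$ (a formal symbol). A 1-cell $\frac{\alpha}{\theta}\colon\frac{X}{G}\to\frac{Y}{H}$ is a pair of a map $\alpha\colon X\to Y$ and a family of maps $\theta=\{\theta_x\colon G\to H\}_{x\in X}$ with $\alpha(gx)=\theta_x(g)\alpha(x)$ and $\theta_x(gg')=\theta_{g'x}(g)\theta_x(g')$ for all $x\in X$, $g,g'\in G$. Composition: $\frac{\beta}{\tau}\circ\frac{\alpha}{\theta}=\frac{\beta\circ\alpha}{\tau\circ\theta}$, where $(\tau\circ\theta)_x=\tau_{\alpha(x)}\circ\theta_x$. The identity of $\frac{X}{G}$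 is given by $\mathrm{id}_X$ and $\theta_x=\mathrm{id}_G$. A 2-cell $\varepsilon\colon\frac{\alpha}{\theta}\Rightarrow\frac{\alpha'}{\theta'}$ between 1-cells $\frac{X}{G}\to\frac{Y}{H}$ is a family $\{\varepsilon_x\in H\}_{x\in X}$ with $\alpha'(x)=\varepsilon_x\alpha(x)$ and $\varepsilon_{gx}\theta_x(g)\varepsilon_x^{-1}=\theta'_x(g)$ for all $x\in X,g\in G$. Vertical composition: $(\varepsilon'\cdot\varepsilon)_x=\varepsilon'_x\varepsilon_x$; all 2-cells are invertible. Whiskering: $(\frac{\beta}{\tau}\circ\varepsilon)_x=\tau_{\alpha(x)}(\varepsilon_x)$ and $(\delta\circ\frac{\alpha}{\theta})_x=\delta_{\alpha(x)}$. Bicoproduct. In a strict 2-category with invertible 2-cells, a bicoproduct of 0-cells $A_1,A_2$ is a 0-cell $A_1\amalg A_2$ with 1-cells $\iota_i\colon A_i\to A_1\amalg A_2$ ($i=1,2$) such that: (i) for any 0-cell $Z$ and 1-cells $f_i\colon A_i\to Z$ there are a 1-cell $f\colon A_1\amalg A_2\to Z$ and 2-cells $\xi_i\colon f\circ\iota_i\Rightarrow f_i$; (ii) for any two such triplets $(f,\xi_1,\xi_2)$, $(f',\xi_1',\xi_2')$ there is a unique 2-cell $\eta\colon f\Rightarrow f'$ with $\xi_i'\cdot(\eta\circ\iota_i)=\xi_i$ ($i=1,2$). Bicoproducts exist in $\mathbb{S}$ and are unique up to equivalence. $\mathbb{B}$. For a 0-cell, $\mathbb{B}(\frac{X}{G})={}_G\mathrm{set}/X$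 (the slice category; objects $(A,\mathfrak{a})$ are $G$-maps $\mathfrak{a}\colon A\to X$). For a 1-cell $\frac{\alpha}{\theta}\colon\frac{X}{G}\to\frac{Y}{H}$, $\mathbb{B}(\frac{\alpha}{\theta})=(\frac{\alpha}{\theta})^*\colon{}_H\mathrm{set}/Y\to{}_G\mathrm{set}/X$ sends $(B,\mathfrak{b})$ to the set $X\times_YB=\{(x,b)\mid\alpha(x)=\mathfrak{b}(b)\}$ with $G$-action $g(x,b)=(gx,\theta_x(g)b)$ and with the projection $p_X$ to $X$, and sends a morphism $f$ to $(x,b)\mapsto(x,f(b))$. *)

(* Defs.v *)
From HB Require Import structures.
From mathcomp Require Import all_boot fingroup.
From Stdlib Require Import FunctionalExtensionality ProofIrrelevance.

Set Implicit Arguments.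
Unset Strict Implicit.
Unset Printing Implicit Defensive.

Record category := Category {
  obj :> Type;
  hom : obj -> obj -> Type;
  idm : forall a, hom a a;
  compm : forall a b c, hom b c -> hom a b -> hom a c;
  compm1 : forall a b (f : hom a b), compm f (idm a) = f;
  comp1m : forall a b (f : hom a b), compm (idm b) f = f;
  compmA : forall a b c d (h : hom c d) (g : hom b c) (f : hom a b),
    compm h (compm g f) = compm (compm h g) f }.

Arguments hom {c} _ _ : rename.
Arguments idm {c} _ : rename.
Arguments compm {c} {_ _ _} _ _ : rename.

Record functor (C D : category) := Functor {
  fobj :> C -> D;
  fmap : forall a b, hom a b -> hom (fobj a) (fobj b);
  fmap1 : forall a, fmap (idm a) = idm (fobj a);
  fmapM : forall a b c (g : hom b c) (f : hom a b),
    fmap (compm g f) = compm (fmap g) (fmap f) }.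

Arguments fmap {C D} _ {a b} _.

Definition id_functor (C : category) : functor C C :=
  {| fobj := fun a => a; fmap := fun a b f => f;
     fmap1 := fun a => erefl; fmapM := fun a b c g f => erefl |}.

Section CompFunctor.
Variables (C D E : category) (K : functor D E) (F : functor C D).

Fact comp_fmap1 a : fmap K (fmap F (idm a)) = idm (K (F a)).
Proof. by rewrite !fmap1. Qed.

Fact comp_fmapM a b c (g : hom b c) (f : hom a b) :
  fmap K (fmap F (compm g f))
  = compm (fmap K (fmap F g)) (fmap K (fmap F f)).
Proof. by rewrite !fmapM. Qed.

Definition comp_functor : functor C E :=
  {| fobj := fun a => K (F a); fmap := fun a b f => fmap K (fmap F f);
     fmap1 := comp_fmap1; fmapM := comp_fmapM |}.
End CompFunctor.

Record nat_iso (C D : category) (F K : functor C D) := NatIso {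
  niso : forall a, hom (F a) (K a);
  niso_inv : forall a, hom (K a) (F a);
  niso_invl : forall a, compm (niso_inv a) (niso a) = idm (F a);
  niso_invr : forall a, compm (niso a) (niso_inv a) = idm (K a);
  niso_nat : forall a b (f : hom a b),
    compm (niso b) (fmap F f) = compm (fmap K f) (niso a) }.

Definition is_equivalence (C D : category) (F : functor C D) : Prop :=
  exists K : functor D C,
    inhabited (nat_iso (id_functor C) (comp_functor K F)) /\
    inhabited (nat_iso (comp_functor F K) (id_functor D)).

Section ProductCategory.
Variables C D : category.

Let phom (a b : C * D) : Type := (hom a.1 b.1 * hom a.2 b.2)%type.
Let pid (a : C * D) : phom a a := (idm a.1, idm a.2).
Let pcomp (a b c : C * D) (g : phom b c) (f : phom a b) : phom a c :=
  (compm g.1 f.1, compm g.2 f.2).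

Fact pcomp1 a b (f : phom a b) : pcomp f (pid a) = f.
Proof. by case: f => f1 f2; rewrite /pcomp /= !compm1. Qed.

Fact p1comp a b (f : phom a b) : pcomp (pid b) f = f.
Proof. by case: f => f1 f2; rewrite /pcomp /= !comp1m. Qed.

Fact pcompA a b c d (h : phom c d) (g : phom b c) (f : phom a b) :
  pcomp h (pcomp g f) = pcomp (pcomp h g) f.
Proof. by rewrite /pcomp /= !compmA. Qed.

Definition prod_category : category :=
  {| obj := C * D; hom := phom; idm := pid; compm := pcomp;
     compm1 := pcomp1; comp1m := p1comp; compmA := pcompA |}.
End ProductCategory.

Section PairFunctor.
Variables (C D E : category) (F : functor C D) (K : functor C E).

Let pobj (a : C) : prod_category D E := (F a, K a).
Let pmap (a b : C) (f : hom a b) : hom (pobj a) (pobj b) :=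
  (fmap F f, fmap K f).

Fact pmap1 a : pmap (idm a) = idm (pobj a).
Proof. by rewrite /pmap !fmap1. Qed.

Fact pmapM a b c (g : hom b c) (f : hom a b) :
  pmap (compm g f) = compm (pmap g) (pmap f).
Proof. by rewrite /pmap !fmapM. Qed.

Definition pair_functor : functor C (prod_category D E) :=
  {| fobj := pobj; fmap := pmap; fmap1 := pmap1; fmapM := pmapM |}.
End PairFunctor.

Section Slice.
Variables (C : category) (x : C).

Record slice_obj := SliceObj { sdom : C; sarr : hom sdom x }.

Record slice_hom (a b : slice_obj) := SliceHom {
  smor :> hom (sdom a) (sdom b);
  smorP : compm (sarr b) smor = sarr a }.

Fact slice_hom_eq a b (f g : slice_hom a b) : smor f = smor g -> f = g.
Proof.
case: f g => [f fP] [g gP] /= e; rewrite -e in gP *.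
by rewrite (proof_irrelevance _ fP gP).
Qed.

Definition slice_id (a : slice_obj) : slice_hom a a :=
  SliceHom (compm1 (sarr a)).

Fact slice_comp_subproof a b c (g : slice_hom b c) (f : slice_hom a b) :
  compm (sarr c) (compm g f) = sarr a.
Proof. by rewrite compmA !smorP. Qed.

Definition slice_comp a b c (g : slice_hom b c) (f : slice_hom a b) :
  slice_hom a c := SliceHom (slice_comp_subproof g f).

Fact slice_comp1 a b (f : slice_hom a b) : slice_comp f (slice_id a) = f.
Proof. by apply: slice_hom_eq; rewrite /= compm1. Qed.

Fact slice_1comp a b (f : slice_hom a b) : slice_comp (slice_id b) f = f.
Proof. by apply: slice_hom_eq; rewrite /= comp1m. Qed.

Fact slice_compA a b c d
    (h : slice_hom c d) (g : slice_hom b c) (f : slice_hom a b) :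
  slice_comp h (slice_comp g f) = slice_comp (slice_comp h g) f.
Proof. by apply: slice_hom_eq; rewrite /= compmA. Qed.

Definition slice_category : category :=
  {| obj := slice_obj; hom := slice_hom; idm := slice_id;
     compm := slice_comp; compm1 := slice_comp1; comp1m := slice_1comp;
     compmA := slice_compA |}.
End Slice.

(** Left actions: the actions of MathComp's [action] file are right actions,
hence a separate structure. *)

Record gset (G : finGroupType) := GSet {
  carrier :> finType;
  gact : G -> carrier -> carrier;
  gact1 : forall x, gact 1%g x = x;
  gactM : forall g h x, gact (g * h)%g x = gact g (gact h x) }.

Arguments gact {G _} _ _ : rename.

Record gmap (G : finGroupType) (A B : gset G) := GMap {
  gfun :> A -> B;
  gfunP : forall g a, gfun (gact g a) = gact g (gfun a) }.

Fact gmap_eq G (A B : gset G) (f g : gmap A B) : f =1 g -> f = g.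
Proof.
case: f g => [f fP] [g gP] /= /functional_extensionality e.
rewrite -e in gP *.
by rewrite (proof_irrelevance _ fP gP).
Qed.

Section GSetCategory.
Variable G : finGroupType.

Definition gmap_id (A : gset G) : gmap A A :=
  {| gfun := fun a => a; gfunP := fun g a => erefl |}.

Fact gmap_comp_subproof (A B C : gset G) (k : gmap B C) (f : gmap A B) g a :
  k (f (gact g a)) = gact g (k (f a)).
Proof. by rewrite !gfunP. Qed.

Definition gmap_comp (A B C : gset G) (k : gmap B C) (f : gmap A B) :
  gmap A C := GMap (gmap_comp_subproof k f).

Fact gmap_comp1 A B (f : gmap A B) : gmap_comp f (gmap_id A) = f.
Proof. exact: gmap_eq. Qed.

Fact gmap_1comp A B (f : gmap A B) : gmap_comp (gmap_id B) f = f.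
Proof. exact: gmap_eq. Qed.

Fact gmap_compA A B C D (h : gmap C D) (k : gmap B C) (f : gmap A B) :
  gmap_comp h (gmap_comp k f) = gmap_comp (gmap_comp h k) f.
Proof. exact: gmap_eq. Qed.

Definition gset_category : category :=
  {| obj := gset G; hom := @gmap G; idm := gmap_id; compm := gmap_comp;
     compm1 := gmap_comp1; comp1m := gmap_1comp; compmA := gmap_compA |}.
End GSetCategory.

(** The 2-category S: [Cell0 X], for [X : gset G], is the 0-cell written X/G;
[cmap] and [ctwist] are the components alpha and theta of a 1-cell. *)
Record cell0 := Cell0 { cgrp : finGroupType; cset :> gset cgrp }.

Record cell1 (A B : cell0) := Cell1 {
  cmap :> A -> B;
  ctwist : A -> cgrp A -> cgrp B;
  cmapP : forall g x, cmap (gact g x) = gact (ctwist x g) (cmap x);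
  ctwistM : forall x g g',
    ctwist x (g * g')%g = (ctwist (gact g' x) g * ctwist x g')%g }.

Section Comp1.
Variables (A B C : cell0) (k : cell1 B C) (f : cell1 A B).

Let kf_twist (x : A) (g : cgrp A) := ctwist k (f x) (ctwist f x g).

Fact comp1_mapP g x : k (f (gact g x)) = gact (kf_twist x g) (k (f x)).
Proof. by rewrite !cmapP. Qed.

Fact comp1_twistM x g g' :
  kf_twist x (g * g')%g = (kf_twist (gact g' x) g * kf_twist x g')%g.
Proof. by rewrite /kf_twist !ctwistM cmapP. Qed.

Definition comp1 : cell1 A C :=
  {| cmap := fun x => k (f x); ctwist := kf_twist;
     cmapP := comp1_mapP; ctwistM := comp1_twistM |}.
End Comp1.

Record cell2 (A B : cell0) (f f' : cell1 A B) := Cell2 {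
  cfam :> A -> cgrp B;
  cfamP : forall x, f' x = gact (cfam x) (f x);
  cfam_twist : forall x g,
    (cfam (gact g x) * ctwist f x g * (cfam x)^-1)%g = ctwist f' x g }.

Section VComp.
Variables (A B : cell0) (f f' f'' : cell1 A B).
Variables (e' : cell2 f' f'') (e : cell2 f f').

Let ee (x : A) : cgrp B := (e' x * e x)%g.

Fact vcomp_mapP x : f'' x = gact (ee x) (f x).
Proof. by rewrite gactM -!cfamP. Qed.

Fact vcomp_twist x g :
  (ee (gact g x) * ctwist f x g * (ee x)^-1)%g = ctwist f'' x g.
Proof. by rewrite -(cfam_twist e') -(cfam_twist e) /ee invMg !mulgA. Qed.

Definition vcomp : cell2 f f'' :=
  {| cfam := ee; cfamP := vcomp_mapP; cfam_twist := vcomp_twist |}.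
End VComp.

Section WhiskerR.
Variables (A B C : cell0) (k k' : cell1 B C).
Variables (d : cell2 k k') (f : cell1 A B).

Fact whiskerR_mapP x : comp1 k' f x = gact (d (f x)) (comp1 k f x).
Proof. exact: (cfamP d). Qed.

Fact whiskerR_twist x g :
  (d (f (gact g x)) * ctwist (comp1 k f) x g * (d (f x))^-1)%g
  = ctwist (comp1 k' f) x g.
Proof. by rewrite cmapP; apply: (cfam_twist d (f x) (ctwist f x g)). Qed.

Definition whiskerR : cell2 (comp1 k f) (comp1 k' f) :=
  {| cfam := fun x => d (f x);
     cfamP := whiskerR_mapP; cfam_twist := whiskerR_twist |}.
End WhiskerR.

(** The definition of bicoproduct in a strict 2-category, instantiated at S. *)
Definition is_bicoproduct (A1 A2 C : cell0)
    (i1 : cell1 A1 C) (i2 : cell1 A2 C) : Prop :=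
  (forall (Z : cell0) (f1 : cell1 A1 Z) (f2 : cell1 A2 Z),
     exists f : cell1 C Z,
       inhabited (cell2 (comp1 f i1) f1) /\
       inhabited (cell2 (comp1 f i2) f2)) /\
  (forall (Z : cell0) (f1 : cell1 A1 Z) (f2 : cell1 A2 Z)
     (f f' : cell1 C Z)
     (xi1 : cell2 (comp1 f i1) f1) (xi2 : cell2 (comp1 f i2) f2)
     (xi1' : cell2 (comp1 f' i1) f1) (xi2' : cell2 (comp1 f' i2) f2),
     exists! eta : cell2 f f',
       vcomp xi1' (whiskerR eta i1) = xi1 /\
       vcomp xi2' (whiskerR eta i2) = xi2).

(** The assignment B: [Bcat] on 0-cells, [pullback] on 1-cells (contravariant). *)
Definition Bcat (A : cell0) : category :=
  slice_category (cset A : gset_category (cgrp A)).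

Section Pullback.
Variables (A B : cell0) (f : cell1 A B).

Section Objects.
Variable b : Bcat B.
Let q : gmap (sdom b) B := sarr b.

Definition pb_type : finType :=
  {p : A * (sdom b : gset _) | f p.1 == q p.2}.

Fact pb_act_subproof (g : cgrp A) (u : pb_type) :
  f (gact g (val u).1) == q (gact (ctwist f (val u).1 g) (val u).2).
Proof. by rewrite cmapP gfunP (eqP (valP u)). Qed.

Definition pb_act (g : cgrp A) (u : pb_type) : pb_type :=
  exist _ (gact g (val u).1, gact (ctwist f (val u).1 g) (val u).2)
        (pb_act_subproof g u).

Fact ctwist1 x : ctwist f x 1%g = 1%g.
Proof.
by apply: (mulgI (ctwist f x 1%g)); rewrite -{1}(gact1 x) -ctwistM !mulg1.
Qed.

Fact pb_act1 u : pb_act 1%g u = u.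
Proof.
by apply: val_inj => /=; rewrite ctwist1 !gact1; case: (val u).
Qed.

Fact pb_actM g h u : pb_act (g * h)%g u = pb_act g (pb_act h u).
Proof. by apply: val_inj; rewrite /= ctwistM !gactM. Qed.

Definition pb_gset : gset (cgrp A) := GSet pb_act1 pb_actM.

Definition pb_proj : gmap pb_gset A :=
  {| gfun := fun u : pb_gset => (val u).1; gfunP := fun g u => erefl |}.

Definition pb_obj : Bcat A :=
  @SliceObj (gset_category (cgrp A)) A pb_gset pb_proj.
End Objects.

Section Morphisms.
Variables (b c : Bcat B) (h : hom b c).
Let hfun : gmap (sdom b) (sdom c) := smor h.

Fact pb_fun_subproof (u : pb_gset b) :
  f (val u).1 == (sarr c : gmap _ _) (hfun (val u).2).
Proof.
rewrite (eqP (valP u)); apply/eqP.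
by have /(congr1 (fun k : gmap _ _ => k (val u).2)) := esym (smorP h).
Qed.

Definition pb_fun (u : pb_gset b) : pb_gset c :=
  exist _ ((val u).1, hfun (val u).2) (pb_fun_subproof u).

Fact pb_funP g u : pb_fun (gact g u) = gact g (pb_fun u).
Proof. by apply: val_inj; rewrite /= gfunP. Qed.

Definition pb_gmap : gmap (pb_gset b) (pb_gset c) := GMap pb_funP.

Fact pb_gmap_over : gmap_comp (pb_proj c) pb_gmap = pb_proj b.
Proof. exact: gmap_eq. Qed.

Definition pb_hom : hom (pb_obj b) (pb_obj c) :=
  @SliceHom (gset_category (cgrp A)) A (pb_obj b) (pb_obj c)
            pb_gmap pb_gmap_over.
End Morphisms.

Fact pb_hom1 b : pb_hom (idm b) = idm (pb_obj b).
Proof.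
apply: slice_hom_eq; apply: gmap_eq => u; apply: val_inj => /=.
by case: (val u).
Qed.

Fact pb_homM b c d (k : hom c d) (h : hom b c) :
  pb_hom (compm k h) = compm (pb_hom k) (pb_hom h).
Proof. by apply: slice_hom_eq; apply: gmap_eq => u; apply: val_inj. Qed.

Definition pullback : functor (Bcat B) (Bcat A) :=
  {| fobj := pb_obj; fmap := pb_hom; fmap1 := pb_hom1; fmapM := pb_homM |}.
End Pullback.

(* Main.v *)
Require Import Defs.
From HB Require Import structures.
From mathcomp Require Import all_boot fingroup.
From mathcomp Require Import gproduct.
From Stdlib Require Import ProofIrrelevance.

Set Implicit Arguments.
Unset Strict Implicit.
Unset Printing Implicit Defensive.

(** The 0-cell X/G is equivalent to (X * H)/(G * H), where H acts on itself by
translation, and likewise Y/H to (G * Y)/(G * H).  So a bicoproduct of X/G and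
Y/H should be P = (X * H + G * Y)/(G * H), which puts both groups together.
For P the claim can be checked by hand: the functor E restricting a G * H-set
over P along the two legs j1, j2 has as quasi-inverse the functor M that sends
(A, B) to A * H + G * B ([sum_functor_inl], [sum_functor_inr],
[sum_functorK]).

It remains to pass from P to an arbitrary bicoproduct C with legs i1, i2 and
restriction functor I.  The universal property of C gives f : C -> P with f i_k isomorphic to
j_k; a direct construction gives g : P -> C with g j_k = i_k ([sum_copair]);
and uniqueness for C makes g f isomorphic to the identity of C.  The assignment
B is pseudofunctorial ([pullback_id], [pullback_comp], [pullback_cell2]), so
that I f^* = E, E g^* = I and f^* g^* = id up to natural isomorphism.
Consequently f^* M is a quasi-inverse of I:
I f^* M = E M = id, and f^* M I = f^* M E g^* = f^* g^* = id.
The equation M E = id stands for uniqueness in the universal property of P. *)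

(** * Natural isomorphisms *)

(** The associativity and unit laws of functors hold on objects and morphisms
by computation, so functors can be compared by equality, up to their proof
fields, and rewritten. *)
Lemma functor_irr (C D : category) (F : C -> D)
    (m : forall a b, hom a b -> hom (F a) (F b)) p1 p2 q1 q2 :
  @Functor C D F m p1 p2 = @Functor C D F m q1 q2.
Proof. by rewrite (proof_irrelevance _ p1 q1) (proof_irrelevance _ p2 q2). Qed.

Lemma comp_functorA (C D E E' : category) (L : functor E E') (K : functor D E)
    (F : functor C D) :
  comp_functor L (comp_functor K F) = comp_functor (comp_functor L K) F.
Proof. exact: functor_irr. Qed.

Lemma comp_id_functor (C D : category) (F : functor C D) :
  comp_functor (id_functor D) F = F.
Proof. by case: F => *; apply: functor_irr. Qed.

Lemma comp_pair_functor (B C D E : category) (F : functor C D)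
    (K : functor C E) (L : functor B C) :
  comp_functor (pair_functor F K) L
  = pair_functor (comp_functor F L) (comp_functor K L).
Proof. exact: functor_irr. Qed.

Lemma niso_sym (C D : category) (F K : functor C D) :
  nat_iso F K -> nat_iso K F.
Proof.
move=> s; apply: (NatIso (niso := niso_inv s) (niso_inv := niso s)).
- exact: niso_invr.
- exact: niso_invl.
move=> a b f.
rewrite -[LHS]compm1 -(niso_invr s a) compmA -(compmA _ (fmap K f)) -niso_nat.
by rewrite compmA niso_invl comp1m.
Qed.

Lemma niso_trans (C D : category) (K F L : functor C D) :
  nat_iso F K -> nat_iso K L -> nat_iso F L.
Proof.
move=> s t; apply: (NatIso (niso := fun a => compm (niso t a) (niso s a))
  (niso_inv := fun a => compm (niso_inv s a) (niso_inv t a))) => [a|a|a b f].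
- by rewrite compmA -(compmA _ (niso_inv t a)) niso_invl compm1 niso_invl.
- by rewrite compmA -(compmA _ (niso s a)) niso_invr compm1 niso_invr.
by rewrite -compmA niso_nat compmA niso_nat compmA.
Qed.

Lemma niso_compl (C D E : category) (L : functor D E) (F K : functor C D) :
  nat_iso F K -> nat_iso (comp_functor L F) (comp_functor L K).
Proof.
move=> s; apply: (@NatIso _ _ (comp_functor L F) (comp_functor L K)
  (fun a => fmap L (niso s a)) (fun a => fmap L (niso_inv s a))) => /=.
- by move=> a; rewrite -fmapM niso_invl fmap1.
- by move=> a; rewrite -fmapM niso_invr fmap1.
by move=> a b f; rewrite -!fmapM niso_nat.
Qed.

Lemma niso_compr (C D E : category) (L : functor C D) (F K : functor D E) :
  nat_iso F K -> nat_iso (comp_functor F L) (comp_functor K L).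
Proof.
move=> s; apply: (@NatIso _ _ (comp_functor F L) (comp_functor K L)
  (fun a => niso s (L a)) (fun a => niso_inv s (L a))) => /=.
- by move=> a; apply: niso_invl.
- by move=> a; apply: niso_invr.
by move=> a b f; apply: niso_nat.
Qed.

Lemma niso_pair (C D E : category) (F F' : functor C D) (K K' : functor C E) :
  nat_iso F F' -> nat_iso K K' ->
  nat_iso (pair_functor F K) (pair_functor F' K').
Proof.
move=> s t; apply: (@NatIso _ _ (pair_functor F K) (pair_functor F' K')
  (fun a => (niso s a, niso t a))
  (fun a => (niso_inv s a, niso_inv t a))) => /=.
- by move=> a; congr pair; apply: niso_invl.
- by move=> a; congr pair; apply: niso_invr.
by move=> a b f; congr pair; apply: niso_nat.
Qed.

Definition fst_functor (C D : category) : functor (prod_category C D) C :=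
  @Functor (prod_category C D) C (fun a => a.1) (fun a b f => f.1)
    (fun a => erefl) (fun a b c g f => erefl).

Definition snd_functor (C D : category) : functor (prod_category C D) D :=
  @Functor (prod_category C D) D (fun a => a.2) (fun a b f => f.2)
    (fun a => erefl) (fun a b c g f => erefl).

(** The objects (a.1, a.2) and a agree only propositionally, hence a natural
isomorphism rather than an equality of functors. *)
Lemma niso_pair_fst_snd (C D : category) :
  nat_iso (pair_functor (fst_functor C D) (snd_functor C D))
    (id_functor (prod_category C D)).
Proof.
apply: (@NatIso _ _ (pair_functor (fst_functor C D) (snd_functor C D))
  (id_functor (prod_category C D))
  (fun a => (idm a.1, idm a.2)) (fun a => (idm a.1, idm a.2))) => /=.
- by move=> a; rewrite /= !compm1.
- by move=> a; rewrite /= !compm1.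
by move=> a b f /=; rewrite !compm1 !comp1m.
Qed.

(** * Isomorphisms of G-sets over a base *)

Lemma gactK (G : finGroupType) (S : gset G) (g : G) :
  cancel (gact g : S -> S) (gact g^-1%g).
Proof. by move=> x; rewrite -gactM mulVg gact1. Qed.

Lemma gactKV (G : finGroupType) (S : gset G) (g : G) :
  cancel (gact g^-1%g : S -> S) (gact g).
Proof. by move=> x; rewrite -gactM mulgV gact1. Qed.

Section OverBase.
Variable A : cell0.
Implicit Types a b : Bcat A.

(** Morphisms over A are seen as maps of finite sets, so that injectivity and
[codom] apply to them. *)
Definition over_fun a b (t : hom a b) : (sdom a : gset _) -> (sdom b : gset _) :=
  gfun (smor t).

Definition over_arr a : (sdom a : gset _) -> A := gfun (sarr a).

Lemma over_funP a b (t : hom a b) u : over_arr (over_fun t u) = over_arr u.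
Proof. by have /(congr1 (fun k : gmap _ _ => k u)) := smorP t. Qed.

Lemma over_hom_eq a b (t t' : hom a b) : over_fun t =1 over_fun t' -> t = t'.
Proof. by move=> e; apply: slice_hom_eq; apply: gmap_eq. Qed.

Section OverHom.
Variables (a b : Bcat A) (t : gmap (sdom a) (sdom b)).
Hypothesis tP : forall u, over_arr (t u) = over_arr u.

Fact over_hom_subproof :
  compm (sarr b) (t : hom (sdom a) (sdom b)) = sarr a.
Proof. exact: gmap_eq. Qed.

Definition over_hom : hom a b := @SliceHom _ _ a b t over_hom_subproof.
End OverHom.

Section Inverse.
Variables (a b : Bcat A) (t : hom a b).
Hypothesis tinj : injective (over_fun t).
Hypothesis tsurj : forall y, y \in codom (over_fun t).

Let inv_fun y := iinv (tsurj y).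

Let over_funK y : over_fun t (inv_fun y) = y.
Proof. exact: f_iinv. Qed.

Let inv_funP g y : inv_fun (gact g y) = gact g (inv_fun y).
Proof. by apply: tinj; rewrite over_funK [RHS]gfunP [gfun _ _]over_funK. Qed.

Let inv_fun_over y : over_arr (GMap inv_funP y) = over_arr y.
Proof. by rewrite -(over_funP t) /= over_funK. Qed.

(** The inverse is found by search in a finite set, which turns surjectivity
into data; [bij_niso] needs this for a whole family of maps at once. *)
Lemma bij_over_iso : {t' : hom b a | compm t' t = idm a & compm t t' = idm b}.
Proof.
exists (over_hom inv_fun_over); apply: over_hom_eq => u; last exact: over_funK.
by apply: tinj; apply: over_funK.
Qed.
End Inverse.

(** All the natural isomorphisms between concrete functors below come from this
criterion: only the map in one direction has to be written down. *)
Lemma bij_niso (D : category) (F K : functor D (Bcat A))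
    (t : forall d, hom (F d) (K d)) :
    (forall d, injective (over_fun (t d))) ->
    (forall d y, y \in codom (over_fun (t d))) ->
    (forall d e (f : hom d e),
      over_fun (t e) \o over_fun (fmap F f)
      =1 over_fun (fmap K f) \o over_fun (t d)) ->
  nat_iso F K.
Proof.
move=> tinj tsurj tnat.
have ti d := bij_over_iso (tinj d) (tsurj d).
apply: (NatIso (niso := t) (niso_inv := fun d => s2val (ti d))).
- by move=> d; case: (ti d).
- by move=> d; case: (ti d).
by move=> d e f; apply: over_hom_eq; apply: tnat.
Qed.
End OverBase.

(** * Pseudofunctoriality of the pullback *)

Definition id_cell1 (A : cell0) : cell1 A A :=
  @Cell1 A A id (fun _ => id) (fun _ _ => erefl) (fun _ _ _ => erefl).

Lemma cell1_eq (A B : cell0) (f g : cell1 A B) :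
  cmap f = cmap g -> ctwist f = ctwist g -> f = g.
Proof.
case: f g => [m t p q] [m' t' p' q'] /= em et.
rewrite -em -et in p' q' *.
by rewrite (proof_irrelevance _ p p') (proof_irrelevance _ q q').
Qed.

Lemma comp1A (A B C D : cell0) (h : cell1 C D) (k : cell1 B C) (f : cell1 A B) :
  comp1 h (comp1 k f) = comp1 (comp1 h k) f.
Proof. exact: cell1_eq. Qed.

Lemma id_comp1 (A B : cell0) (f : cell1 A B) : comp1 (id_cell1 B) f = f.
Proof. exact: cell1_eq. Qed.

Lemma cell2_refl (A B : cell0) (f : cell1 A B) : cell2 f f.
Proof.
apply: (@Cell2 _ _ f f (fun _ => 1%g)) => [x|x g]; first by rewrite gact1.
by rewrite mul1g invg1 mulg1.
Qed.

(** The twist of k, evaluated on both sides of the identity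
e_(g x) * theta_x(g) = theta'_x(g) * e_x, gives the twist condition of the
whiskered 2-cell, by the cocycle law of k. *)
Section WhiskerL.
Variables (A B C : cell0) (k : cell1 B C) (f f' : cell1 A B) (e : cell2 f f').

Lemma whiskerL : cell2 (comp1 k f) (comp1 k f').
Proof.
apply: (@Cell2 _ _ (comp1 k f) (comp1 k f') (fun x => ctwist k (f x) (e x))).
  by move=> x /=; rewrite -cmapP -cfamP.
move=> x g /=; apply/(canLR (mulgK _)).
rewrite (cfamP e x) -ctwistM cmapP -ctwistM -(cfam_twist e x g).
by rewrite mulgKV.
Qed.
End WhiskerL.

Section PullbackId.
Variable A : cell0.

Definition pullback_id_fun (b : Bcat A) (u : pb_gset (id_cell1 A) b) :
  (sdom b : gset _) := (val u).2.

Fact pullback_id_over (b : Bcat A) (u : pb_gset (id_cell1 A) b) :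
  over_arr (pullback_id_fun u) = (val u).1.
Proof. exact/esym/eqP/(valP u). Qed.

Definition pullback_id_hom (b : Bcat A) : hom (pullback (id_cell1 A) b) b :=
  @over_hom A (pullback (id_cell1 A) b) b
    (@GMap _ _ _ (@pullback_id_fun b) (fun _ _ => erefl)) (@pullback_id_over b).

Lemma pullback_id : nat_iso (pullback (id_cell1 A)) (id_functor (Bcat A)).
Proof.
apply: (@bij_niso A _ (pullback (id_cell1 A)) (id_functor _) pullback_id_hom)
  => //.
- move=> b [[x u] /= xu] [[y v] /= yv] uv; apply: val_inj => /=.
  have {}uv : u = v := uv.
  by move: xu yv => /eqP-> /eqP->; rewrite uv.
- move=> b u; apply/codomP.
  by exists (exist _ (over_arr u, u) (eqxx _)).
Qed.
End PullbackId.

Section PullbackComp.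
Variables (A B C : cell0) (k : cell1 B C) (f : cell1 A B).

Section Component.
Variable c : Bcat C.
Let lhs : Bcat A := comp_functor (pullback f) (pullback k) c.
Let rhs : Bcat A := pullback (comp1 k f) c.

Fact pullback_comp_subproof (u : pb_gset f (pb_obj k c)) :
  comp1 k f (val u).1 == over_arr (val (val u).2).2.
Proof. by rewrite /= (eqP (valP u)) /=; apply: (valP (val u).2). Qed.

Let fwd_fun (u : pb_gset f (pb_obj k c)) : pb_gset (comp1 k f) c :=
  exist _ ((val u).1, (val (val u).2).2) (pullback_comp_subproof u).

Fact pullback_comp_gmapP g u : fwd_fun (gact g u) = gact g (fwd_fun u).
Proof. by apply: val_inj; rewrite /= (eqP (valP u)). Qed.

Definition pullback_comp_hom : hom lhs rhs :=
  @over_hom A lhs rhs (GMap pullback_comp_gmapP) (fun _ => erefl).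

Lemma pullback_comp_inj : injective (over_fun pullback_comp_hom).
Proof.
move=> [[x [[y u] /= yu]] /= xy] [[x' [[y' u'] /= yu']] /= xy'] [ex eu].
apply: val_inj => /=; rewrite ex; congr pair.
apply: val_inj; rewrite /= eu; congr pair.
by move: xy xy' => /eqP <- /eqP <-; rewrite ex.
Qed.

Lemma pullback_comp_surj u : u \in codom (over_fun pullback_comp_hom).
Proof.
case: u => [[x u] /= xu]; apply/codomP.
pose v : pb_gset k c := exist _ (f x, u) xu.
by exists (exist _ (x, v) (eqxx _)); apply: val_inj.
Qed.
End Component.

Lemma pullback_comp :
  nat_iso (comp_functor (pullback f) (pullback k)) (pullback (comp1 k f)).
Proof.
apply: (bij_niso pullback_comp_inj pullback_comp_surj) => c d h u.
exact: val_inj.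
Qed.
End PullbackComp.

(** A 2-cell e acts on the fibres: (x, u) lies over f when (x, e_x u) lies over
f', and the twist condition on e is the equivariance of this map. *)
Section PullbackCell2.
Variables (A B : cell0) (f f' : cell1 A B) (e : cell2 f f').

Section Component.
Variable b : Bcat B.

Fact pullback_cell2_subproof (u : pb_gset f b) :
  f' (val u).1 == over_arr (gact (e (val u).1) (val u).2).
Proof. by rewrite (cfamP e) /over_arr gfunP (eqP (valP u)). Qed.

Let fwd_fun (u : pb_gset f b) : pb_gset f' b :=
  exist _ ((val u).1, gact (e (val u).1) (val u).2) (pullback_cell2_subproof u).

Fact pullback_cell2_gmapP g u : fwd_fun (gact g u) = gact g (fwd_fun u).
Proof.
by apply: val_inj; rewrite /= -!gactM -(cfam_twist e) mulgKV.
Qed.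

Definition pullback_cell2_hom : hom (pullback f b) (pullback f' b) :=
  @over_hom A (pullback f b) (pullback f' b)
    (GMap pullback_cell2_gmapP) (fun _ => erefl).

Lemma pullback_cell2_inj : injective (over_fun pullback_cell2_hom).
Proof.
move=> [[x u] /= xu] [[y v] /= yv] [exy euv]; apply: val_inj => /=.
by move: euv; rewrite exy => /(can_inj (gactK _)) ->.
Qed.

Lemma pullback_cell2_surj u : u \in codom (over_fun pullback_cell2_hom).
Proof.
case: u => [[x u] /= xu]; apply/codomP.
have xv : f x == over_arr (gact (e x)^-1%g u).
  by rewrite /over_arr gfunP -(eqP xu) (cfamP e) gactK.
exists (exist _ (x, gact (e x)^-1%g u) xv).
by apply: val_inj; rewrite /= gactKV.
Qed.
End Component.

Lemma pullback_cell2 : nat_iso (pullback f) (pullback f').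
Proof.
apply: (bij_niso pullback_cell2_inj pullback_cell2_surj) => c d h u.
by apply: val_inj; rewrite /= gfunP.
Qed.
End PullbackCell2.

(** * A model of the bicoproduct *)

(** This is the sum of the G * H-sets induced from A and B along the inclusions
of G and H: A * H is (G * H) *_G A, because each coset of G
in G * H has a unique representative in H. *)
Section SumGset.
Variables (G H : finGroupType).

Section Objects.
Variables (A : gset G) (B : gset H).

Let sum_act (k : G * H) (u : A * H + G * B) : A * H + G * B :=
  match u with
  | inl (a, h) => inl (gact k.1 a, (k.2 * h)%g)
  | inr (g, b) => inr ((k.1 * g)%g, gact k.2 b)
  end.

Fact sum_act1 u : sum_act 1%g u = u.
Proof. by case: u => [[a h]|[g b]] /=; rewrite gact1 mul1g. Qed.

Fact sum_actM k l u : sum_act (k * l)%g u = sum_act k (sum_act l u).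
Proof. by case: u => [[a h]|[g b]] /=; rewrite gactM mulgA. Qed.

Definition sum_gset : gset (G * H)%type :=
  @GSet (G * H)%type (A * H + G * B)%type sum_act sum_act1 sum_actM.
End Objects.

Section Morphisms.
Variables (A A' : gset G) (B B' : gset H) (p : gmap A A') (q : gmap B B').

Let sum_fun (u : sum_gset A B) : sum_gset A' B' :=
  match u with
  | inl (a, h) => inl (p a, h)
  | inr (g, b) => inr (g, q b)
  end.

Fact sum_funP k u : sum_fun (gact k u) = gact k (sum_fun u).
Proof. by case: u => [[a h]|[g b]] /=; rewrite gfunP. Qed.

Definition sum_gmap : gmap (sum_gset A B) (sum_gset A' B') := GMap sum_funP.
End Morphisms.
End SumGset.

Section Model.
Variables (G H : finGroupType) (X : gset G) (Y : gset H).

Definition sum_cell0 : cell0 := Cell0 (sum_gset X Y).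

Definition sum_inl : cell1 (Cell0 X) sum_cell0.
Proof.
refine (@Cell1 (Cell0 X) sum_cell0 (fun x => inl (x, 1%g))
  (fun _ g => (g, 1%g)) _ _) => [g x|_ g g'] /=.
  by rewrite mulg1.
by congr pair; rewrite mulg1.
Defined.

Definition sum_inr : cell1 (Cell0 Y) sum_cell0.
Proof.
refine (@Cell1 (Cell0 Y) sum_cell0 (fun y => inr (1%g, y))
  (fun _ h => (1%g, h)) _ _) => [h y|_ h h'] /=.
  by rewrite mulg1.
by congr pair; rewrite mulg1.
Defined.

(** The copairing forgets the regular factors: it is f1 x at every (x, h), and
its twist there is that of f1 at x, trivial on H. *)
Lemma sum_copair (Z : cell0) (f1 : cell1 (Cell0 X) Z) (f2 : cell1 (Cell0 Y) Z) :
  exists f : cell1 sum_cell0 Z, comp1 f sum_inl = f1 /\ comp1 f sum_inr = f2.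
Proof.
pose m (u : sum_cell0) : Z :=
  match u with inl (x, _) => f1 x | inr (_, y) => f2 y end.
pose t (u : sum_cell0) (k : G * H) : cgrp Z :=
  match u with inl (x, _) => ctwist f1 x k.1 | inr (_, y) => ctwist f2 y k.2 end.
have mP (k : cgrp sum_cell0) u : m (gact k u) = gact (t u k) (m u).
  by case: u => [[x h]|[g y]]; [apply: (cmapP f1) | apply: (cmapP f2)].
have tM u (k l : cgrp sum_cell0) :
    t u (k * l)%g = (t (gact l u) k * t u l)%g.
  by case: u => [[x h]|[g y]]; [apply: (ctwistM f1) | apply: (ctwistM f2)].
exists (Cell1 mP tM).
by split; apply: cell1_eq.
Qed.

Let BX := Bcat (Cell0 X).
Let BY := Bcat (Cell0 Y).

Definition sum_obj (ab : prod_category BX BY) : Bcat sum_cell0 :=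
  @SliceObj (gset_category (G * H)%type) (sum_gset X Y)
    (sum_gset (sdom ab.1) (sdom ab.2)) (sum_gmap (sarr ab.1) (sarr ab.2)).

Fact sum_hom_subproof (a b : prod_category BX BY) (t : hom a b) u :
  over_arr (a := sum_obj b) (sum_gmap (smor t.1) (smor t.2) u)
  = over_arr (a := sum_obj a) u.
Proof.
case: u => [[v h]|[g v]].
  exact (congr1 (fun x : X => inl (x, h) : sum_gset X Y) (over_funP t.1 v)).
exact (congr1 (fun y : Y => inr (g, y) : sum_gset X Y) (over_funP t.2 v)).
Qed.

Definition sum_hom (a b : prod_category BX BY) (t : hom a b) :
  hom (sum_obj a) (sum_obj b) :=
  @over_hom sum_cell0 (sum_obj a) (sum_obj b) _ (sum_hom_subproof t).

Fact sum_hom1 a : sum_hom (idm a) = idm (sum_obj a).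
Proof. by apply: over_hom_eq => -[[v h]|[g v]]. Qed.

Fact sum_homM (a b c : prod_category BX BY) (s : hom b c) (t : hom a b) :
  sum_hom (compm s t) = compm (sum_hom s) (sum_hom t).
Proof. by apply: over_hom_eq => -[[v h]|[g v]]. Qed.

Definition sum_functor : functor (prod_category BX BY) (Bcat sum_cell0) :=
  {| fobj := sum_obj; fmap := sum_hom; fmap1 := sum_hom1; fmapM := sum_homM |}.

(** The fibre over (x, 1) of the summand A * H is the copy A * {1} of the fibre
of A over x, and the summand G * B does not meet it. *)
Section RestrictInl.
Variable ab : prod_category BX BY.
Let res := comp_functor (pullback sum_inl) sum_functor ab.

Definition restrict_inl_fun (a : sdom ab.1 : gset G) :
  pb_gset sum_inl (sum_functor ab) :=
  exist _ (over_arr a, inl (a, 1%g)) (eqxx _).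

Fact restrict_inl_funP g a :
  restrict_inl_fun (gact g a) = gact g (restrict_inl_fun a).
Proof. by apply: val_inj; rewrite /= mulg1 /over_arr gfunP. Qed.

Definition restrict_inl_hom : hom (ab.1 : BX) res :=
  @over_hom _ ab.1 res (GMap restrict_inl_funP) (fun _ => erefl).

Lemma restrict_inl_inj : injective (over_fun restrict_inl_hom).
Proof. by move=> u v [_ ->]. Qed.

Lemma restrict_inl_surj u : u \in codom (over_fun restrict_inl_hom).
Proof.
case: u => [[z [[a h]|[g b]]] //= e]; apply/codomP.
exists a; apply: val_inj => /=.
by move: e => /eqP[-> <-].
Qed.
End RestrictInl.

Lemma sum_functor_inl :
  nat_iso (fst_functor BX BY) (comp_functor (pullback sum_inl) sum_functor).
Proof.
apply: (@bij_niso _ _ (fst_functor BX BY)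
  (comp_functor (pullback sum_inl) sum_functor) restrict_inl_hom
  restrict_inl_inj restrict_inl_surj) => c d t u.
by apply: val_inj; rewrite /= over_funP.
Qed.

Section RestrictInr.
Variable ab : prod_category BX BY.
Let res := comp_functor (pullback sum_inr) sum_functor ab.

Definition restrict_inr_fun (b : sdom ab.2 : gset H) :
  pb_gset sum_inr (sum_functor ab) :=
  exist _ (over_arr b, inr (1%g, b)) (eqxx _).

Fact restrict_inr_funP g b :
  restrict_inr_fun (gact g b) = gact g (restrict_inr_fun b).
Proof. by apply: val_inj; rewrite /= mulg1 /over_arr gfunP. Qed.

Definition restrict_inr_hom : hom (ab.2 : BY) res :=
  @over_hom _ ab.2 res (GMap restrict_inr_funP) (fun _ => erefl).

Lemma restrict_inr_inj : injective (over_fun restrict_inr_hom).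
Proof. by move=> u v [_ ->]. Qed.

Lemma restrict_inr_surj u : u \in codom (over_fun restrict_inr_hom).
Proof.
case: u => [[z [[a h]|[g b]]] //= e]; apply/codomP.
exists b; apply: val_inj => /=.
by move: e => /eqP[<- ->].
Qed.
End RestrictInr.

Lemma sum_functor_inr :
  nat_iso (snd_functor BX BY) (comp_functor (pullback sum_inr) sum_functor).
Proof.
apply: (@bij_niso _ _ (snd_functor BX BY)
  (comp_functor (pullback sum_inr) sum_functor) restrict_inr_hom
  restrict_inr_inj restrict_inr_surj) => c d t u.
by apply: val_inj; rewrite /= over_funP.
Qed.

(** Every point of X * H is the translate of some (x, 1) by a unique element of
H, so a G * H-set over P is recovered from its restriction to the points (x, 1)
and (1, y) by translating. *)
Section Glue.
Variable s : Bcat sum_cell0.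
Let res := pair_functor (pullback sum_inl) (pullback sum_inr) s.
Let act (k : G * H) (w : sdom s : gset (G * H)%type) := gact k w.

Definition glue_fun (u : sum_gset (pb_gset sum_inl s) (pb_gset sum_inr s)) :
  (sdom s : gset (G * H)%type) :=
  match u with
  | inl (v, h) => act (1%g, h) (val v).2
  | inr (g, v) => act (g, 1%g) (val v).2
  end.

Fact glue_funP k u : glue_fun (gact k u) = gact k (glue_fun u).
Proof.
by case: k u => [g h] [[v h']|[g' v]] /=; rewrite /act -!gactM;
  congr gact; congr pair; rewrite /= ?mulg1 ?mul1g.
Qed.

Fact glue_over u : over_arr (glue_fun u) = over_arr (a := sum_functor res) u.
Proof.
case: u => [[v h]|[g v]]; rewrite /over_arr /= gfunP -(eqP (valP v)) /=;
  by rewrite gact1 mulg1.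
Qed.

Definition glue_hom : hom (sum_functor res) s :=
  @over_hom sum_cell0 (sum_functor res) s (GMap glue_funP) glue_over.

Lemma glue_inj : injective (over_fun glue_hom).
Proof.
(* The image determines the point of P below it, hence the translating element. *)
move=> u v uv; have := over_funP glue_hom u; rewrite uv over_funP.
case: u v uv => [[[[x w] /= xw] h]|[g [[y w] /= yw]]];
  case=> [[[[x' w'] /= xw'] h']|[g' [[y' w'] /= yw']]] //= uv [].
  move=> ex eh; subst x' h'; congr (inl (_, _)); apply: val_inj => /=.
  by have /= -> := can_inj (gactK _) uv.
move=> eg ey; subst y' g'; congr (inr (_, _)); apply: val_inj => /=.
by have /= -> := can_inj (gactK _) uv.
Qed.

Lemma glue_surj w : w \in codom (over_fun glue_hom).
Proof.
apply/codomP; case e : (over_arr w) => [[x h]|[g y]].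
  have xw : sum_inl x == over_arr (act (1%g, h)^-1%g w).
    by rewrite /over_arr gfunP [gfun _ _]e /= invg1 gact1 mulVg.
  exists (inl (exist _ (x, act (1%g, h)^-1%g w) xw, h)).
  by rewrite /over_fun /= /act gactKV.
have yw : sum_inr y == over_arr (act (g, 1%g)^-1%g w).
  by rewrite /over_arr gfunP [gfun _ _]e /= invg1 gact1 mulVg.
exists (inr (g, exist _ (y, act (g, 1%g)^-1%g w) yw)).
by rewrite /over_fun /= /act gactKV.
Qed.
End Glue.

Lemma sum_functorK :
  nat_iso (comp_functor sum_functor
             (pair_functor (pullback sum_inl) (pullback sum_inr)))
          (id_functor (Bcat sum_cell0)).
Proof.
apply: (@bij_niso _ _ (comp_functor sum_functor
  (pair_functor (pullback sum_inl) (pullback sum_inr))) (id_functor _)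
  glue_hom glue_inj glue_surj) => s s' t [[v h]|[g v]] /=;
  by rewrite /over_fun /= gfunP.
Qed.
End Model.

Theorem proposition6p1 (G H : finGroupType) (X : gset G) (Y : gset H)
    (C : cell0) (i1 : cell1 (Cell0 X) C) (i2 : cell1 (Cell0 Y) C)
    (hC : is_bicoproduct i1 i2) :
  is_equivalence (pair_functor (pullback i1) (pullback i2)).
Proof.
case: hC => hC1 hC2.
have [f [[x1] [x2]]] := hC1 _ (sum_inl X Y) (sum_inr X Y).
have [g [g1 g2]] := sum_copair i1 i2.
pose I := pair_functor (pullback i1) (pullback i2).
pose E := pair_functor (pullback (sum_inl X Y)) (pullback (sum_inr X Y)).
pose M := sum_functor X Y.
have If : nat_iso (comp_functor I (pullback f)) E.
  rewrite comp_pair_functor; apply: niso_pair.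
    exact: niso_trans (pullback_comp _ _) (pullback_cell2 x1).
  exact: niso_trans (pullback_comp _ _) (pullback_cell2 x2).
have Eg : nat_iso (comp_functor E (pullback g)) I.
  rewrite comp_pair_functor /I -g1 -g2.
  by apply: niso_pair; apply: pullback_comp.
have EM : nat_iso (comp_functor E M) (id_functor _).
  rewrite comp_pair_functor; apply: niso_trans (niso_pair_fst_snd _ _).
  apply: niso_pair; apply: niso_sym.
    exact: sum_functor_inl.
  exact: sum_functor_inr.
have gf1 : cell2 (comp1 (comp1 g f) i1) i1.
  by rewrite -comp1A -{2}g1; apply: whiskerL.
have gf2 : cell2 (comp1 (comp1 g f) i2) i2.
  by rewrite -comp1A -{2}g2; apply: whiskerL.
have id1 : cell2 (comp1 (id_cell1 C) i1) i1 by rewrite id_comp1; apply: cell2_refl.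
have id2 : cell2 (comp1 (id_cell1 C) i2) i2 by rewrite id_comp1; apply: cell2_refl.
have [gf _] := hC2 _ _ _ _ _ gf1 gf2 id1 id2.
have fg : nat_iso (comp_functor (pullback f) (pullback g)) (id_functor (Bcat C)).
  apply: niso_trans (pullback_comp _ _) _.
  exact: niso_trans (pullback_cell2 gf) (pullback_id C).
exists (comp_functor (pullback f) M); split; constructor.
  apply: niso_sym; apply: niso_trans fg.
  rewrite -comp_functorA; apply: niso_compl.
  (* It remains to compare M I = M E g^* with g^*. *)
  rewrite -[X in nat_iso _ X]comp_id_functor.
  apply: niso_trans (niso_compr (pullback g) (sum_functorK X Y)).
  rewrite -comp_functorA; apply: niso_compl.
  exact: niso_sym.
rewrite comp_functorA; apply: niso_trans EM.
exact: niso_compr.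
Qed.
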